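(* Let $\mathbb{F}=\mathbb{R}$ or $\mathbb{F}=\mathbb{C}$. For any $n$ and $d$, $$\mathcal{ON}_2\cap S^d(\mathbb{F}^n)=\mathcal{SON}_2\cap S^d(\mathbb{F}^n)=\mathcal{CON}_2\cap S^d(\mathbb{F}^n)=\{\sigma_1v_1^{\otimes d}+\sigma_2v_2^{\otimes d} : \sigma_1,\sigma_2\in\mathbb{F},\ v_1,v_2\in\mathbb{F}^n,\ v_1\perp v_2\}.$$
   Context: Tensors carry the inner product $\langle T,S\rangle=\sum_{i_1,\dots,i_d}T(i_1,\dots,i_d)\overline{S(i_1,\dots,i_d)}$. $S^d(\mathbb{F}^n)$ denotes the tensors in $\mathbb{F}^{n\times\cdots\times n}$ ($d$ factors) invariant under all permutations of the $d$ indices; $v^{\otimes d}$ is the $d$-fold tensor power. Two tensors $x=x_1\otimes\cdots\otimes x_d$ and $y=y_1\otimes\cdots\otimes y_d$ are: orthogonal if $\langle x,y\rangle=\prod_j\langle x_j,y_j\rangle=0$; strongly orthogonal if they are orthogonal and for each $j$ either $\langle x_j,y_j\rangle=0$ or $x_j=\mu_jy_j$ for some non-zero $\mu_j\in\mathbb{F}$; completely orthogonal if $\langle x_j,y_j\rangle=0$ for all $j$. $\mathcal{ON}_r$, $\mathcal{SON}_r$, $\mathcal{CON}_r$ (here for tensors in $\mathbb{F}^{n\times\cdots\times n}$) are the sets of all tensors of the form $\sum_{k=1}^r\sigma_k\,v_{k1}\otimes\cdots\otimes v_{kd}$ with $\sigma_k\in\mathbb{F}$ (zero coefficients or zero vectors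 allowed, so that the rank is at most $r$) whose terms are pairwise orthogonal, strongly orthogonal, completely orthogonal, respectively. *)

(* Defs.v *)
From mathcomp Require Import all_boot all_order all_algebra all_fingroup.
From mathcomp Require Import boolp classical_sets reals.
From mathcomp.real_closed Require Import complex.

Set Implicit Arguments.
Unset Strict Implicit.
Unset Printing Implicit Defensive.

Import GRing.Theory.
Local Open Scope classical_set_scope.
Local Open Scope ring_scope.

(* Throughout, [theta] is the conjugation of the scalar field: the identity for
   the real numbers and [conjc] for the complex numbers. *)

Section Tensors.
Variables (F : fieldType) (theta : F -> F) (n d : nat).

(* T(i_1, ..., i_d) is [T i], for a multi-index [i : {ffun 'I_d -> 'I_n}]. *)
Definition tensor := {ffun {ffun 'I_d -> 'I_n} -> F}.

Definition dotv (u v : 'rV[F]_n) : F := \sum_(i < n) u 0 i * theta (v 0 i).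

Definition dott (T S : tensor) : F := \sum_i T i * theta (S i).

Definition tprod (x : 'I_d -> 'rV[F]_n) : tensor :=
  [ffun i : {ffun 'I_d -> 'I_n} => \prod_(j < d) x j 0 (i j)].

Definition tpow (v : 'rV[F]_n) : tensor := tprod (fun=> v).

Definition symmetric_tensors : set tensor :=
  [set T | forall (s : 'S_d) (i : {ffun 'I_d -> 'I_n}),
    T [ffun j => i (s j)] = T i].

(* The orthogonality notions depend on the chosen factors of an elementary
   tensor, so they are relations between families of factors. *)
Definition orthogonal_factors (x y : 'I_d -> 'rV[F]_n) : Prop :=
  dott (tprod x) (tprod y) = 0.

Definition strongly_orthogonal_factors (x y : 'I_d -> 'rV[F]_n) : Prop :=
  orthogonal_factors x y /\
  forall j, dotv (x j) (y j) = 0 \/ exists2 mu : F, mu != 0 & x j = mu *: y j.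

Definition completely_orthogonal_factors (x y : 'I_d -> 'rV[F]_n) : Prop :=
  forall j, dotv (x j) (y j) = 0.

Definition decomposable (orth : ('I_d -> 'rV[F]_n) -> ('I_d -> 'rV[F]_n) -> Prop)
    (r : nat) : set tensor :=
  [set T | exists (sigma : 'I_r -> F) (v : 'I_r -> 'I_d -> 'rV[F]_n),
     (forall k l, k != l -> orth (v k) (v l)) /\
     T = [ffun i => \sum_(k < r) sigma k * tprod (v k) i]].

Definition ON := decomposable orthogonal_factors.
Definition SON := decomposable strongly_orthogonal_factors.
Definition CON := decomposable completely_orthogonal_factors.

Definition two_orthogonal_powers : set tensor :=
  [set T | exists (sigma1 sigma2 : F) (v1 v2 : 'rV[F]_n),
     dotv v1 v2 = 0 /\
     T = [ffun i => sigma1 * tpow v1 i + sigma2 * tpow v2 i]].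

End Tensors.

Lemma dott_tprod (F : fieldType) (theta : {rmorphism F -> F}) (n d : nat)
    (x y : 'I_d -> 'rV[F]_n) :
  dott theta (tprod x) (tprod y) = \prod_(j < d) dotv theta (x j) (y j).
Proof.
rewrite /dott /dotv bigA_distr_bigA; apply: eq_bigr => i _.
by rewrite !ffunE rmorph_prod -big_split.
Qed.

Arguments symmetric_tensors F n d : clear implicits.
Arguments ON {F} theta n d r.
Arguments SON {F} theta n d r.
Arguments CON {F} theta n d r.
Arguments two_orthogonal_powers {F} theta n d.

(* Main.v *)
Require Import Defs.
From mathcomp Require Import all_boot all_order all_algebra all_fingroup.
From mathcomp Require Import boolp classical_sets reals.
From mathcomp.real_closed Require Import complex.
From mathcomp Require Import ring lra.

Set Implicit Arguments.
Unset Strict Implicit.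
Unset Printing Implicit Defensive.

Import Order.TTheory GRing.Theory Num.Theory.

Local Open Scope classical_set_scope.
Local Open Scope ring_scope.

(** A symmetric tensor [T] is studied through the form
    [f |-> <T, f_1 (x) ... (x) f_d>], which is invariant under exchanging two
    slots.  Let [T = s1 x_1 (x) ... (x) x_d + s2 y_1 (x) ... (x) y_d] with
    [x_k] orthogonal to [y_k].  If slot [l] satisfies "[x_l], [y_l] independent",
    evaluating this slot at a vector orthogonal to [y_l] kills the second term,
    and the symmetry of what remains forces all [x_i], [i <> l], to be parallel.
    With two such slots and [d >= 3], all [x_i] are parallel to [x_k] and all
    [y_i] to [y_k]; if [k] is the only such slot, [T] has rank one.  For [d = 2]
    one needs the Takagi factorization of a symmetric form on the plane spanned
    by [x_k] and [y_k], which amounts to a quadratic equation with real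
    coefficients and a negative product of roots. *)

Section TwoTerms.
Context {F : numFieldType} (theta : {rmorphism F -> F}).
Hypothesis thetaK : involutive theta.
Hypothesis mul_theta_gt0 : forall z : F, z != 0 -> 0 < z * theta z.
(** This stands in for square roots of positive scalars fixed by [theta], so that one proof covers
    real and complex scalars. *)
Hypothesis fixed_quadratic_root : forall a b k : F, 0 < a -> 0 < b ->
  theta k = k -> exists2 t, theta t = t & a * t ^+ 2 - b = k * t.
Context {n d : nat}.

Local Notation "''[' u , v ]" := (dotv theta u v).
Local Notation factors := ('I_d -> 'rV[F]_n).
Implicit Types (u v w a b : 'rV[F]_n) (x y f g : factors).

(** * The sesquilinear form on row vectors *)

Lemma dotvDl u v w : '[u + v, w] = '[u, w] + '[v, w].
Proof. by rewrite /dotv -big_split; apply: eq_bigr => i _; rewrite mxE mulrDl. Qed.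

Lemma dotvZl c u w : '[c *: u, w] = c * '[u, w].
Proof. by rewrite /dotv big_distrr; apply: eq_bigr => i _; rewrite /= mxE mulrA. Qed.

Lemma dotvC u v : '[u, v] = theta '[v, u].
Proof.
by rewrite /dotv rmorph_sum; apply: eq_bigr => i _; rewrite rmorphM thetaK mulrC.
Qed.

Lemma dotvDr u v w : '[w, u + v] = '[w, u] + '[w, v].
Proof. by rewrite !(dotvC w) dotvDl rmorphD. Qed.

Lemma dotvZr c u w : '[w, c *: u] = theta c * '[w, u].
Proof. by rewrite !(dotvC w) dotvZl rmorphM. Qed.

Lemma dotv0r u : '[u, 0] = 0.
Proof. by rewrite -(scale0r u) dotvZr rmorph0 mul0r. Qed.

Lemma dotvv_gt0 u : u != 0 -> 0 < '[u, u].
Proof.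
have ge0 (z : F) : 0 <= z * theta z.
  by have [->|/mul_theta_gt0/ltW //] := eqVneq z 0; rewrite mul0r.
case/rV0Pn => i ui0; rewrite /dotv (bigD1 i) //=.
by rewrite ltr_wpDr ?mul_theta_gt0 // sumr_ge0.
Qed.

Lemma dotvv_neq0 u : u != 0 -> '[u, u] != 0.
Proof. by move/dotvv_gt0/lt0r_neq0. Qed.

Lemma dotv_inj u v : (forall w, '[u, w] = '[v, w]) -> u = v.
Proof.
move=> uv; apply/eqP; rewrite -subr_eq0; apply/negP => /negP/dotvv_neq0/eqP; apply.
by rewrite dotvDl -scaleN1r dotvZl uv mulN1r subrr.
Qed.

Lemma parallel_sym u v c : u != 0 -> u = c *: v -> exists c', v = c' *: u.
Proof.
move=> u0 uE; have c0: c != 0 by apply: contraNneq u0 => c0; rewrite uE c0 scale0r.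
by exists c^-1; rewrite uE scalerA mulVf // scale1r.
Qed.

(** The witness is the component of [u] orthogonal to [v]; its product with [u] is its own squared
    norm. *)
Lemma separating_vector u v : v != 0 -> ~ (exists c, u = c *: v) ->
  exists2 w, '[v, w] = 0 & '[u, w] != 0.
Proof.
move=> v0 npar; set c := '[u, v] / '[v, v].
have vw : '[v, u - c *: v] = 0.
  by rewrite dotvC -scaleNr dotvDl dotvZl mulNr divfK ?dotvv_neq0 // subrr rmorph0.
exists (u - c *: v) => //.
have -> : '[u, u - c *: v] = '[u - c *: v, u - c *: v].
  by rewrite -scaleNr [in RHS]dotvDl dotvZl scaleNr vw mulr0 addr0.
apply: dotvv_neq0; apply/eqP => /eqP; rewrite subr_eq0 => /eqP uE.
by apply: npar; exists c.
Qed.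

(** * Evaluation of two-term tensors and exchange of slots *)

Definition two_term (s1 s2 : F) x y : tensor F n d :=
  [ffun i => s1 * tprod x i + s2 * tprod y i].

Lemma two_termC s1 s2 x y : two_term s1 s2 x y = two_term s2 s1 y x.
Proof. by apply/ffunP => i; rewrite !ffunE addrC. Qed.

Lemma dott_two_term s1 s2 x y f :
  dott theta (two_term s1 s2 x y) (tprod f) =
  s1 * (\prod_j '[x j, f j]) + s2 * (\prod_j '[y j, f j]).
Proof.
rewrite -!dott_tprod /dott !big_distrr -big_split; apply: eq_bigr => i _ /=.
by rewrite ffunE; ring.
Qed.

Lemma symmetric_dott (T : tensor F n d) (s : 'S_d) f :
  symmetric_tensors F n d T ->
  dott theta T (tprod (fun j => f (s j))) = dott theta T (tprod f).
Proof.
move=> symT; rewrite /dott.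
pose h (p : 'S_d) (i : {ffun 'I_d -> 'I_n}) := [ffun j => i (p j)].
have hK : cancel (h s) (h s^-1)%g.
  by move=> i; apply/ffunP => j; rewrite !ffunE permKV.
rewrite [LHS](reindex_inj (can_inj hK)) /=; apply: eq_bigr => i _.
rewrite symT !ffunE; congr (_ * theta _).
rewrite [RHS](reindex_inj (@perm_inj _ s)) /=.
by apply: eq_bigr => j _; rewrite ffunE.
Qed.

(** The scalar left of an elementary tensor evaluated at [g] when slots [i] and [j] are kept
    free. *)
Definition rest x g i j := \prod_(l | (l != i) && (l != j)) '[x l, g l].

Lemma two_term_exchange s1 s2 x y g i j u v : i != j ->
  symmetric_tensors F n d (two_term s1 s2 x y) ->
  s1 * ('[x i, u] * '[x j, v] * rest x g i j) +
  s2 * ('[y i, u] * '[y j, v] * rest y g i j) =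
  s1 * ('[x i, v] * '[x j, u] * rest x g i j) +
  s2 * ('[y i, v] * '[y j, u] * rest y g i j).
Proof.
move=> ij symT.
pose f (u v : 'rV[F]_n) l := if l == i then u else if l == j then v else g l.
have prodE z (p q : 'rV[F]_n) :
    \prod_l '[z l, f p q l] = '[z i, p] * '[z j, q] * rest z g i j.
  rewrite (bigD1 i) //= (bigD1 j) 1?eq_sym //= /f !eqxx eq_sym (negPf ij) mulrA.
  by congr (_ * _); apply: eq_bigr => l /andP[/negPf -> /negPf ->].
have := symmetric_dott (tperm i j) (f v u) symT.
rewrite !dott_two_term !prodE => <-; rewrite -!prodE.
have fE l : f v u (tperm i j l) = f u v l.
  rewrite /f; case: tpermP => [->|->|/eqP/negPf -> /eqP/negPf -> //].
  - by rewrite eqxx eq_sym (negPf ij) eqxx.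
  - by rewrite eqxx eq_sym (negPf ij) eqxx.
by congr (_ * _ + _ * _); apply: eq_bigr => l _; rewrite fE.
Qed.

(** * Parallel factors forced by symmetry *)

(** With the second term killed, the exchange identity equates ['[x i, w] * '[x j, v]] and
    ['[x i, v] * '[x j, w]]; take [v = x j] and divide by its squared norm. *)
Lemma parallel_of_rest s1 s2 x y g i j : i != j -> x j != 0 ->
  symmetric_tensors F n d (two_term s1 s2 x y) ->
  s2 * rest y g i j = 0 -> s1 * rest x g i j != 0 ->
  exists c, x i = c *: x j.
Proof.
move=> ij xj0 symT y0 x0; exists ('[x i, x j] / '[x j, x j]).
apply: dotv_inj => w; rewrite dotvZl.
have := two_term_exchange g w (x j) ij symT.
have sl (z s A B : F) : s * (A * B * z) = s * z * (A * B) by ring.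
rewrite !sl y0 !mul0r !addr0 => /(mulfI x0) E.
by rewrite mulrAC -E mulfK ?dotvv_neq0.
Qed.

Lemma rest_self_neq0 x i j : (forall l, x l != 0) -> rest x x i j != 0.
Proof. by move=> x0; apply/prodf_neq0 => l _; apply: dotvv_neq0. Qed.

Lemma parallel_off_slot s1 s2 x y i j l :
  s1 != 0 -> (forall m, x m != 0) -> y l != 0 ->
  symmetric_tensors F n d (two_term s1 s2 x y) ->
  ~ (exists c, x l = c *: y l) -> i != l -> j != l ->
  exists c, x i = c *: x j.
Proof.
move=> s10 x0 yl0 symT npar il jl.
have [->|ij] := eqVneq i j; first by exists 1; rewrite scale1r.
have [w yw xw] := separating_vector yl0 npar.
(* At slot [l] the vector [w] annihilates the [y] term; [x] itself elsewhere keeps the [x] term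
   non-zero. *)
pose g m := if m == l then w else x m.
apply: (parallel_of_rest (g := g) ij (x0 j) symT).
  by rewrite /rest (bigD1 l) /= ?(eq_sym l) ?il // /g eqxx yw mul0r mulr0.
rewrite mulf_neq0 //; apply/prodf_neq0 => m _; rewrite /g.
by case: (m =P l) => [->|_] //; apply: dotvv_neq0.
Qed.

(** * Parallel families and rank-one tensors *)

Lemma tprod_parallel x a (c : 'I_d -> F) i :
  (forall l, x l = c l *: a) -> tprod x i = (\prod_l c l) * tpow d a i.
Proof.
by move=> xE; rewrite !ffunE -big_split; apply: eq_bigr => l _; rewrite xE mxE.
Qed.

Lemma two_powers_of_parallel s1 s2 x y a b : '[a, b] = 0 ->
  (forall l, exists c, x l = c *: a) -> (forall l, exists c, y l = c *: b) ->
  two_orthogonal_powers theta n d (two_term s1 s2 x y).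
Proof.
move=> ab /choice[c xE] /choice[e yE].
exists (s1 * \prod_l c l), (s2 * \prod_l e l), a, b; split=> //.
apply/ffunP => i.
by rewrite [LHS]ffunE [RHS]ffunE (tprod_parallel _ xE) (tprod_parallel _ yE) !mulrA.
Qed.

Lemma two_powers0 : two_orthogonal_powers theta n d [ffun=> 0].
Proof.
exists 0, 0, 0, 0; split; first exact: dotv0r.
by apply/ffunP => i; rewrite !ffunE !mul0r addr0.
Qed.

Lemma tprod0 x l i : x l = 0 -> tprod x i = 0.
Proof. by move=> xl; rewrite ffunE (bigD1 l) //= xl mxE mul0r. Qed.

Lemma two_powers_rank_one s x : (0 < d)%N ->
  symmetric_tensors F n d [ffun i => s * tprod x i] ->
  two_orthogonal_powers theta n d [ffun i => s * tprod x i].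
Proof.
move=> d0; have TE : [ffun i => s * tprod x i] = two_term s 0 x (fun=> 0).
  by apply/ffunP => i; rewrite !ffunE mul0r addr0.
have [-> _|s0] := eqVneq s 0.
  by rewrite (_ : finfun _ = [ffun=> 0]); [exact: two_powers0 |
     apply/ffunP => i; rewrite !ffunE mul0r].
have [/existsP[l /eqP xl] _|/existsPn x0] := boolP [exists l, x l == 0].
  rewrite (_ : finfun _ = [ffun=> 0]); first exact: two_powers0.
  by apply/ffunP => i; rewrite [LHS]ffunE (tprod0 i xl) mulr0 ffunE.
rewrite TE => symT; pose k := Ordinal d0.
apply: (@two_powers_of_parallel _ _ _ _ (x k) 0) => [|l|l].
- exact: dotv0r.
- have [->|lk] := eqVneq l k; first by exists 1; rewrite scale1r.
  apply: (parallel_of_rest (g := x) lk (x0 k) symT); rewrite ?mul0r //.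
  by rewrite mulf_neq0 ?rest_self_neq0.
- by exists 0; rewrite scaler0.
Qed.

(** * Order two: Takagi factorization on a plane *)

(** The expression is fixed by [theta] exactly when [w * z] is, where [w = p + theta r];
    [z = theta w] turns the latter into a norm. *)
Lemma fixed_direction p r :
  exists2 z, z != 0 & theta (p * z - r * theta z) = p * z - r * theta z.
Proof.
pose w := p + theta r.
have [z z0 zw] : exists2 z, z != 0 & theta (w * z) = w * z.
  have [w0|w0] := eqVneq w 0.
    by exists 1; rewrite ?oner_eq0 // w0 mul0r rmorph0.
  by exists (theta w); rewrite ?fmorph_eq0 // rmorphM thetaK mulrC.
exists z => //; apply/eqP; rewrite -subr_eq0 rmorphB !rmorphM thetaK.
move: zw; rewrite /w rmorphM rmorphD thetaK => /eqP; rewrite -subr_eq0 => /eqP <-.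
by apply/eqP; ring.
Qed.

(* The form [p aa + q (ab + ba) + r bb] is diagonalized in the basis
   [v1 = al a + be b], [v2 = - be^* |b|^2 a + al^* |a|^2 b]; its off-diagonal
   coefficient vanishes iff the stated equation on [al], [be] holds. *)
Lemma takagi_rotation (Na Nb p q r : F) : 0 < Na -> 0 < Nb ->
  theta Na = Na -> theta Nb = Nb ->
  exists al be : F,
    al * theta al * Na + be * theta be * Nb != 0 /\
    q * (al * theta al * Na - be * theta be * Nb) =
    p * theta al * be * Na - r * theta be * al * Nb.
Proof.
move=> Na0 Nb0 rNa rNb.
have [->|q0] := eqVneq q 0.
  exists 1, 0; rewrite !rmorph0 !rmorph1; split; last by ring.
  by rewrite !mul1r !mul0r addr0 lt0r_neq0.
(* For [al = theta (t * z)], [be = 1] and [t] fixed by [theta], the equation divided by [q] is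
   quadratic in [t] with linear coefficient [k]; [z] is chosen to make [k] fixed. *)
pose p' := p * Na / q; pose r' := r * Nb / q.
have [z z0] := fixed_direction p' r'; set k := _ - _ => kR.
have [|t tR tE] := @fixed_quadratic_root (z * theta z * Na) Nb k _ Nb0 kR.
  by rewrite mulr_gt0 ?mul_theta_gt0.
exists (theta (t * z)), 1; rewrite thetaK !rmorph1 !rmorphM tR; split.
  rewrite lt0r_neq0 // !mul1r ltr_wpDl // mulr_ge0 ?(ltW Na0) //.
  have [->|t0] := eqVneq t 0; first by rewrite !mul0r.
  by rewrite mulrC ltW // -{2}tR -rmorphM mul_theta_gt0 ?mulf_neq0.
transitivity (q * (z * theta z * Na * t ^+ 2 - Nb)); first by ring.
by rewrite tE /k /p' /r'; field.
Qed.

(** The order [d = 2] is expressed by two distinct slots that exhaust ['I_d], and [p], [q], [r] are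
    the entries of a symmetric matrix in the basis [a], [b]. *)
Lemma two_powers_plane (T : tensor F n d) a b p q r :
  a != 0 -> b != 0 -> '[a, b] = 0 ->
  (exists k1 k2, k1 != k2 /\ (forall l, l = k1 \/ l = k2) /\
    forall i : {ffun 'I_d -> 'I_n}, T i =
      a 0 (i k1) * (p * a 0 (i k2) + q * b 0 (i k2)) +
      b 0 (i k1) * (q * a 0 (i k2) + r * b 0 (i k2))) ->
  two_orthogonal_powers theta n d T.
Proof.
move=> a0 b0 ab [k1 [k2 [k12 [kP TE]]]].
have rN u : theta '[u, u] = '[u, u] by rewrite -dotvC.
have [al [be []]] := takagi_rotation p q r (dotvv_gt0 a0) (dotvv_gt0 b0) (rN a) (rN b).
set Na := '[a, a]; set Nb := '[b, b] => De0 offdiag.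
(* [C] and [D] are the coordinates of the second basis vector, [De] the determinant of the change of
   basis. *)
pose C := - (theta be * Nb); pose D := theta al * Na; pose De := al * D - be * C.
have De0' : De != 0 by rewrite (_ : De = al * theta al * Na + be * theta be * Nb) // /De /C /D; ring.
have {}offdiag : - p * D * be + q * (D * al + C * be) - r * C * al = 0.
  transitivity (q * (al * theta al * Na - be * theta be * Nb) -
    (p * theta al * be * Na - r * theta be * al * Nb)); first by rewrite /C /D; ring.
  by rewrite offdiag subrr.
(* Diagonal entries in the new basis, obtained by substituting [a = (D v1 - be v2) / De] and
   [b = (al v2 - C v1) / De]. *)
pose t1 := (p * D ^+ 2 - q * C * D *+ 2 + r * C ^+ 2) / De ^+ 2.
pose t2 := (p * be ^+ 2 - q * al * be *+ 2 + r * al ^+ 2) / De ^+ 2.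
exists t1, t2, (al *: a + be *: b), (C *: a + D *: b); split.
  have ba : '[b, a] = 0 by rewrite dotvC ab rmorph0.
  rewrite !dotvDl !dotvDr !dotvZl !dotvZr ab ba -/Na -/Nb /C /D.
  by rewrite rmorphN !rmorphM !thetaK !rN -/Na -/Nb; ring.
apply/ffunP => i; rewrite TE !ffunE.
have prodE (v : 'rV[F]_n) : \prod_j v 0 (i j) = v 0 (i k1) * v 0 (i k2).
  rewrite (bigD1 k1) //= (bigD1 k2) 1?eq_sym //= big1 ?mulr1 // => l.
  by case: (kP l) => ->; rewrite eqxx ?andbF.
rewrite !prodE !mxE.
move: (a 0 _) (a 0 _) (b 0 _) (b 0 _) => a1 a2 b1 b2.
(* With the off-diagonal term [s12] kept, the change of basis back is a rational identity; its
   vanishing is used only afterwards. *)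
pose s12 := - p * D * be + q * (D * al + C * be) - r * C * al.
have pE : p = t1 * al ^+ 2 + t2 * C ^+ 2 + s12 * (al * C *+ 2) / De ^+ 2.
  by rewrite /t1 /t2 /s12; move: De0'; rewrite /De => ?; field.
have qE : q = t1 * al * be + t2 * C * D + s12 * (al * D + be * C) / De ^+ 2.
  by rewrite /t1 /t2 /s12; move: De0'; rewrite /De => ?; field.
have rE : r = t1 * be ^+ 2 + t2 * D ^+ 2 + s12 * (be * D *+ 2) / De ^+ 2.
  by rewrite /t1 /t2 /s12; move: De0'; rewrite /De => ?; field.
move: pE qE rE; rewrite {}/s12 offdiag !mul0r !addr0.
by move: t1 t2 => t1 t2 -> -> ->; ring.
Qed.

(** Writing the tensor as [a (x) u + b (x) w], symmetry puts [u] and [w] in the span of [a] and [b],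
    with a symmetric coefficient matrix. *)
Lemma two_powers_matrix s1 s2 x y k1 k2 :
  k1 != k2 -> (forall l, l = k1 \/ l = k2) ->
  x k1 != 0 -> y k1 != 0 -> '[x k1, y k1] = 0 ->
  symmetric_tensors F n d (two_term s1 s2 x y) ->
  two_orthogonal_powers theta n d (two_term s1 s2 x y).
Proof.
move=> k12 kP; set a := x k1; set b := y k1 => a0 b0 ab symT.
have [u uD] : exists u, u = s1 *: x k2 by exists (s1 *: x k2).
have [w wD] : exists w, w = s2 *: y k2 by exists (s2 *: y k2).
have ba : '[b, a] = 0 by rewrite dotvC ab rmorph0.
have exch (f g : 'rV[F]_n) : '[a, f] * '[u, g] + '[b, f] * '[w, g] =
    '[a, g] * '[u, f] + '[b, g] * '[w, f].
  (* No third slot exists, so [rest] is an empty product and the test family 0 is harmless. *)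
  have := two_term_exchange (fun=> 0) f g k12 symT.
  have r1 (z : factors) : rest z (fun=> 0) k1 k2 = 1.
    by rewrite /rest big1 // => l; case: (kP l) => ->; rewrite eqxx ?andbF.
  have sl (A A' B B' : F) :
      A * (s1 * B) + A' * (s2 * B') = s1 * (A * B * 1) + s2 * (A' * B' * 1) by ring.
  by rewrite !r1 uD wD !dotvZl !sl.
pose p := '[u, a] / '[a, a]; pose q := '[w, a] / '[a, a].
pose r := '[w, b] / '[b, b].
have Na0 := dotvv_neq0 a0; have Nb0 := dotvv_neq0 b0.
have qE : q = '[u, b] / '[b, b].
  have := exch a b; rewrite ab ba !mul0r addr0 add0r => E.
  by apply/eqP; rewrite eqr_div // mulrC -E mulrC.
have uE : u = p *: a + q *: b.
  apply: dotv_inj => g; rewrite dotvDl !dotvZl; apply: (mulfI Na0).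
  by have := exch a g; rewrite ba mul0r addr0 => ->; rewrite /p /q; field.
have wE : w = q *: a + r *: b.
  apply: dotv_inj => g; rewrite dotvDl !dotvZl; apply: (mulfI Nb0).
  by have := exch b g; rewrite ab mul0r add0r => ->; rewrite qE /r; field.
apply: (@two_powers_plane _ a b p q r) => //.
exists k1, k2; split=> //; split=> // i.
have prodE (z : factors) : tprod z i = z k1 0 (i k1) * z k2 0 (i k2).
  rewrite ffunE (bigD1 k1) //= (bigD1 k2) 1?eq_sym //= big1 ?mulr1 // => l.
  by case: (kP l) => ->; rewrite eqxx ?andbF.
have cu j : s1 * x k2 0 j = p * a 0 j + q * b 0 j.
  by have /matrixP/(_ 0 j) := uE; rewrite uD !mxE.
have cw j : s2 * y k2 0 j = q * a 0 j + r * b 0 j.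
  by have /matrixP/(_ 0 j) := wE; rewrite wD !mxE.
by rewrite ffunE !prodE -cu -cw -/a -/b; ring.
Qed.

(** * Case analysis on the slots with independent factors *)

Lemma two_powers_of_symmetric s1 s2 x y : (0 < d)%N ->
  orthogonal_factors theta x y ->
  symmetric_tensors F n d (two_term s1 s2 x y) ->
  two_orthogonal_powers theta n d (two_term s1 s2 x y).
Proof.
move=> d0; rewrite /orthogonal_factors dott_tprod => /eqP/prodf_eq0[k _ /eqP xy].
have degenerate s1' s2' (x' y' : factors) :
    (s2' = 0 \/ exists l, y' l = 0) ->
    symmetric_tensors F n d (two_term s1' s2' x' y') ->
    two_orthogonal_powers theta n d (two_term s1' s2' x' y').
  move=> H; rewrite (_ : two_term s1' s2' x' y' = [ffun i => s1' * tprod x' i]).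
    exact: two_powers_rank_one.
  apply/ffunP => i; rewrite [LHS]ffunE [RHS]ffunE.
  by case: H => [->|[l /(tprod0 i) ->]]; rewrite ?mul0r ?mulr0 addr0.
have [->|s10] := eqVneq s1 0; first by rewrite two_termC; apply: degenerate; left.
have [->|s20] := eqVneq s2 0; first by apply: degenerate; left.
have [/existsP[l /eqP xl]|/existsPn x0] := boolP [exists l, x l == 0].
  by rewrite two_termC; apply: degenerate; right; exists l.
have [/existsP[l /eqP yl]|/existsPn y0] := boolP [exists l, y l == 0].
  by apply: degenerate; right; exists l.
move=> symT.
have npark (c : F) : x k <> c *: y k.
  move=> xk; have [c' yk] := parallel_sym (x0 k) xk.
  have: '[x k, x k] = 0.
    by rewrite [X in '[_, X]]xk dotvZr xy mulr0.
  by apply/eqP/dotvv_neq0.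
have [[l lk npar]|par] :=
    pselect (exists2 l, l != k & ~ exists c, x l = c *: y l); last first.
  have /choice[c cE] : forall l, exists c, l != k -> y l = c *: x l.
    move=> l; have [->|lk] := eqVneq l k; first by exists 0.
    have [[c xl]|npar] := pselect (exists c, x l = c *: y l).
      by have [c' ?] := parallel_sym (x0 l) xl; exists c'.
    by case: par; exists l.
  (* Only slot [k] has independent factors, so both terms share their other factors up to scalars
     and merge into one elementary tensor. *)
  pose z l := if l == k then s1 *: x k + (s2 * \prod_(m | m != k) c m) *: y k else x l.
  have TE : two_term s1 s2 x y = [ffun i => 1 * tprod z i].
    apply/ffunP => i; rewrite [LHS]ffunE [RHS]ffunE mul1r.
    have prodE (v : factors) :
        tprod v i = v k 0 (i k) * \prod_(m | m != k) v m 0 (i m).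
      by rewrite ffunE (bigD1 k).
    have zE : \prod_(m | m != k) z m 0 (i m) = \prod_(m | m != k) x m 0 (i m).
      by apply: eq_bigr => m /negPf mk; rewrite /z mk.
    have yE : \prod_(m | m != k) y m 0 (i m) =
        (\prod_(m | m != k) c m) * \prod_(m | m != k) x m 0 (i m).
      by rewrite -big_split; apply: eq_bigr => m mk; rewrite cE // mxE.
    by rewrite !prodE zE yE /z eqxx !mxE; ring.
  by move: symT; rewrite TE; apply: two_powers_rank_one.
have [[m mk ml]|only2] := pselect (exists2 m, m != k & m != l); last first.
  apply: (@two_powers_matrix _ _ _ _ k l) => //; first by rewrite eq_sym.
  move=> m; have [|mk] := eqVneq m k; first by left.
  by have [|ml] := eqVneq m l; [right | case: only2; exists m].
have all_parallel s1' s2' (x' y' : factors) : s1' != 0 -> (forall i, x' i != 0) ->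
    (forall i, y' i != 0) -> symmetric_tensors F n d (two_term s1' s2' x' y') ->
    ~ (exists c, x' k = c *: y' k) -> ~ (exists c, x' l = c *: y' l) ->
    forall i, exists c, x' i = c *: x' k.
  move=> s0 x'0 y'0 sym' nk nl i.
  have [->|ik] := eqVneq i k; first by exists 1; rewrite scale1r.
  (* The third slot [m] is the link: freeing [k] makes [x' i] parallel to [x' m], freeing [l] makes
     [x' m] parallel to [x' k]. *)
  have [c1 E1] := parallel_off_slot s0 x'0 (y'0 k) sym' nk ik mk.
  have kl : k != l by rewrite eq_sym.
  have [c2 E2] := parallel_off_slot s0 x'0 (y'0 l) sym' nl ml kl.
  by exists (c1 * c2); rewrite E1 E2 scalerA.
have nparC j : ~ (exists c, x j = c *: y j) -> ~ (exists c, y j = c *: x j).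
  by move=> H [c /(parallel_sym (y0 j))].
have nk : ~ exists c, x k = c *: y k by case=> c /npark.
apply: (two_powers_of_parallel _ _ xy).
  exact: all_parallel symT nk npar.
move: symT; rewrite two_termC => symT'.
exact: all_parallel symT' (nparC _ nk) (nparC _ npar).
Qed.

(** * The cycle of inclusions *)

(** One slot is enough to make the product of the ['[x j, y j]] vanish; for [d = 0] that product
    would be 1. *)
Lemma CON_sub_SON r : (0 < d)%N -> CON theta n d r `<=` SON theta n d r.
Proof.
move=> d0 T [s [v [orth TE]]]; exists s, v; split=> // k l kl; split; last first.
  by move=> j; left; apply: orth.
rewrite /orthogonal_factors dott_tprod (bigD1 (Ordinal d0)) //=.
by rewrite (orth _ _ kl) mul0r.
Qed.

Lemma SON_sub_ON r : SON theta n d r `<=` ON theta n d r.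
Proof. by move=> T [s [v [orth TE]]]; exists s, v; split=> // k l /orth[]. Qed.

Lemma two_powers_sub_CON :
  two_orthogonal_powers theta n d `<=`
  CON theta n d 2 `&` symmetric_tensors F n d.
Proof.
move=> T [s1 [s2 [v1 [v2 [v12 ->]]]]]; split.
  exists (fun k => if k == 0 then s1 else s2), (fun k _ => if k == 0 then v1 else v2).
  split; last by apply/ffunP => i; rewrite !ffunE !big_ord_recl big_ord0 addr0 !ffunE.
  have v21 : '[v2, v1] = 0 by rewrite dotvC v12 rmorph0.
  by move=> [[|[|?]] //= ?] [[|[|?]] //= ?] kl j.
move=> s i; rewrite !ffunE.
by congr (_ * _ + _ * _); rewrite [RHS](reindex_inj (@perm_inj _ s)) /=;
  apply: eq_bigr => j _; rewrite ffunE.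
Qed.

Lemma ON_symmetric_sub_two_powers : (0 < d)%N ->
  ON theta n d 2 `&` symmetric_tensors F n d `<=` two_orthogonal_powers theta n d.
Proof.
move=> d0 T [[s [v [orth TE]]]].
have {TE}-> : T = two_term (s 0) (s 1) (v 0) (v 1).
  rewrite TE; apply/ffunP => i; rewrite [LHS]ffunE [RHS]ffunE.
  rewrite !big_ord_recl big_ord0 addr0; congr (_ + s _ * tprod (v _) i); exact: val_inj.
by apply: two_powers_of_symmetric => //; apply: orth.
Qed.

Lemma ON2_SON2_CON2_symmetric : (0 < d)%N ->
  let S := symmetric_tensors F n d in
  [/\ ON theta n d 2 `&` S = SON theta n d 2 `&` S,
      SON theta n d 2 `&` S = CON theta n d 2 `&` S
    & CON theta n d 2 `&` S = two_orthogonal_powers theta n d].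
Proof.
move=> d0 S.
have CS := @CON_sub_SON 2 d0; have SO := @SON_sub_ON 2.
have OP := ON_symmetric_sub_two_powers d0; have PC := two_powers_sub_CON.
split; apply/seteqP; split=> T.
- by move=> TO; have [/CS] := PC _ (OP _ TO).
- by case=> /SO.
- by case=> /SO TO TS; apply: PC; apply: OP.
- by case=> /CS.
- by case=> /CS/SO TO TS; apply: OP.
- exact: PC.
Qed.

End TwoTerms.

(** * Real and complex scalars *)

Lemma quadratic_root_rcf (R : rcfType) (a b k : R) : 0 < a -> 0 < b ->
  exists t, a * t ^+ 2 - b = k * t.
Proof.
move=> a0 b0; set D := k ^+ 2 + 4 * a * b.
have D0 : 0 <= D by rewrite addr_ge0 ?sqr_ge0 // ltW // !mulr_gt0.
exists ((k + Num.sqrt D) / (2 * a)).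
have sE := sqr_sqrtr D0; set s := Num.sqrt D in sE *.
have a0' := lt0r_neq0 a0.
(* Eliminating [b] through the discriminant leaves a rational identity in [a], [k], [s]. *)
have -> : b = (s ^+ 2 - k ^+ 2) / (4 * a) by rewrite sE /D; field.
by field.
Qed.

Theorem theorem4p5 (R : realType) (n d : nat) (d_gt0 : (0 < d)%N) :
  (let S := symmetric_tensors R n d in
   let conj := @idfun R in
   [/\ ON conj n d 2 `&` S = SON conj n d 2 `&` S,
       SON conj n d 2 `&` S = CON conj n d 2 `&` S
     & CON conj n d 2 `&` S = two_orthogonal_powers conj n d])
  /\
  (let S := symmetric_tensors (complex R) n d in
   let conj := @conjc R in
   [/\ ON conj n d 2 `&` S = SON conj n d 2 `&` S,
       SON conj n d 2 `&` S = CON conj n d 2 `&` S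
     & CON conj n d 2 `&` S = two_orthogonal_powers conj n d]).
Proof.
split.
  apply: (@ON2_SON2_CON2_symmetric R (@idfun R)) => //.
  - by move=> z z0; rewrite -expr2 exprn_even_gt0.
  - move=> a b k a0 b0 _.
    by have [t tE] := @quadratic_root_rcf R a b k a0 b0; exists t.
apply: (@ON2_SON2_CON2_symmetric (complex R) (@conjc R)) => //.
- exact: conjcK.
- by move=> z z0; rewrite -sqr_normc exprn_gt0 ?normr_gt0.
(* Positivity of [a], [b] and invariance of [k] under conjugation kill the imaginary parts, which
   leaves the real quadratic. *)
- move=> [a ai] [b bi] [k ki]; rewrite !ltcE /= => /andP[/eqP -> a0] /andP[/eqP -> b0].
  case=> kiN; have -> : ki = 0 by lra.
  have [t tE] := @quadratic_root_rcf R a b k a0 b0; exists (t%:C)%C.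
    by rewrite /= oppr0.
  have -> : (k +i* 0 = k%:C)%C by [].
  have -> : (a +i* 0 = a%:C)%C by [].
  have -> : (b +i* 0 = b%:C)%C by [].
  by rewrite -rmorphXn -!rmorphM -rmorphB tE.
Qed.
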